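(* Let $X = X_1 \cup X_2 \cup X_3 \subset \mathbb{R}^2$ be the Warsaw circle, where $X_1 = \{(a, |\sin(\pi/a)|) : a \in (0,1]\}$, $X_2 = \{(a,b) \in \mathbb{R}^2 : (a-1/2)^2 + b^2 = 1/4 \text{ and } b < 0\}$ and $X_3 = \{(0,b) : b \in [0,1]\}$, with the subspace topology. Then the hyperspace $\mathcal{S}_c(X)$ of nontrivial convergent sequences of $X$, with the Vietoris topology, has $\mathfrak{c}$-many path-wise connected components (that is, the set of its path components has cardinality $\mathfrak{c}$).
   Context: $\mathfrak{c}$ is the cardinality of the continuum. For a topological space $X$, $\mathcal{CL}(X)$ denotes the set of all nonempty closed subsets of $X$. For a nonempty family $\mathcal{U}$ of subsets of $X$, $\langle \mathcal{U}\rangle = \{F \in \mathcal{CL}(X) : F \subseteq \bigcup \mathcal{U} \text{ and } F \cap U \neq \emptyset \text{ for all } U \in \mathcal{U}\}$. The Vietoris topology on $\mathcal{CL}(X)$ has as a base the sets $\langle \mathcal{U}\rangle$, where $\mathcal{U}$ runs over all nonempty finite families of nonempty open subsets of $X$; every subset of $\mathcal{CL}(X)$ carries the subspace topology. A nontrivial convergent sequence of $X$ is a subset $S \subseteq X$ such that $|S| = \omega$ (countably infinite), $S$ (as a subspace) has a unique non-isolated point $x_S$, and $S \setminus U$ is finite for each neighborhood $U$ of $x_S$. Then $\mathcal{S}_c(X) = \{S \in \mathcal{CL}(X) : S \text{ is a nontrivial convergent sequence}\}$. *)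

(* Defs.v *)
From HB Require Import structures.
From mathcomp Require Import all_boot all_order all_algebra.
From mathcomp Require Import all_classical all_reals all_analysis.
Import Order.TTheory GRing.Theory Num.Theory.
Import numFieldNormedType.Exports.

Set Implicit Arguments.
Unset Strict Implicit.
Unset Printing Implicit Defensive.

Local Open Scope classical_set_scope.
Local Open Scope ring_scope.
Local Open Scope card_scope.

Definition closed_nonempty (X : topologicalType) : set (set X) :=
  [set F | closed F /\ F !=set0].

(* A separate name, so that the Vietoris topology does not compete with the
   subspace topology that the library puts on every [set_type]. *)
Definition hyperspace (X : topologicalType) : Type :=
  set_type (@closed_nonempty X).

HB.instance Definition _ (X : topologicalType) :=
  SubChoice.copy (hyperspace X) (set_type (@closed_nonempty X)).

Section vietoris.
Variable X : topologicalType.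

Definition vietoris_family : set (set (set X)) :=
  [set U | [/\ finite_set U, U !=set0 &
    forall V, U V -> open V /\ V !=set0]].

Definition vietoris_basic (U : set (set X)) : set (hyperspace X) :=
  [set F | \val F `<=` \bigcup_(V in U) V /\
    forall V, U V -> \val F `&` V !=set0].

Lemma vietoris_basic_cover :
  \bigcup_(U in vietoris_family) vietoris_basic U = setT.
Proof.
apply/seteqP; split=> // F _.
have [_ [x Fx]] : closed_nonempty (\val F) := set_valP F.
exists [set setT]; first split.
- exact: finite_set1.
- by exists setT.
- by move=> _ ->; split; [exact: openT|exists x].
- split; first by move=> y _; exists setT.
  by move=> _ ->; exists x.
Qed.

Lemma vietoris_basic_join (U V : set (set X)) (F : hyperspace X) :
  vietoris_family U -> vietoris_family V ->
  vietoris_basic U F -> vietoris_basic V F ->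
  exists W, [/\ vietoris_family W, vietoris_basic W F &
    vietoris_basic W `<=` vietoris_basic U `&` vietoris_basic V].
Proof.
move=> [finU [A0 UA0] oU] [finV [B0 VB0] oV] [FU meetU] [FV meetV].
pose f A := A `&` \bigcup_(B in V) B.
pose g B := B `&` \bigcup_(A in U) A.
have Ff A : U A -> \val F `&` f A !=set0.
  by move=> /meetU[x [Fx Ax]]; exists x; split=> //; split=> //; exact: FV.
have Fg B : V B -> \val F `&` g B !=set0.
  by move=> /meetV[x [Fx Bx]]; exists x; split=> //; split=> //; exact: FU.
exists (f @` U `|` g @` V); split.
- split.
  + by rewrite finite_setU; split; exact: finite_image.
  + by exists (f A0); left; exists A0.
  + move=> _ [[A UA <-]|[B VB <-]]; split.
    * apply: openI; first exact: (oU _ UA).1.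
      by apply: bigcup_open => B /oV[].
    * by have [x [_ fx]] := Ff _ UA; exists x.
    * apply: openI; first exact: (oV _ VB).1.
      by apply: bigcup_open => A /oU[].
    * by have [x [_ gx]] := Fg _ VB; exists x.
- split.
  + move=> x Fx; have [A UA Ax] := FU x Fx; exists (f A).
      by left; exists A.
    by split=> //; exact: FV.
  + by move=> _ [[A UA <-]|[B VB <-]]; [exact: Ff|exact: Fg].
- move=> G [GW meetW]; split; split.
  + by move=> x /GW[_ [[A UA <-] [Ax _]|[B VB <-] [_ ?]]] //; exists A.
  + move=> A UA; have [|x [Gx [Ax _]]] := meetW (f A).
      by left; exists A.
    by exists x.
  + by move=> x /GW[_ [[A UA <-] [_ ?]|[B VB <-] [Bx _]]] //; exists B.
  + move=> B VB; have [|x [Gx [Bx _]]] := meetW (g B).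
      by right; exists B.
    by exists x.
Qed.

HB.instance Definition _ := @isBaseTopological.Build (hyperspace X)
  (set (set X)) vietoris_family vietoris_basic
  vietoris_basic_cover vietoris_basic_join.

Lemma vietoris_openE : @open (hyperspace X) =
  [set \bigcup_(U in D) vietoris_basic U | D in subset^~ vietoris_family].
Proof. by []. Qed.

End vietoris.

(* The library's [isolated S] is the set of isolated points of the subspace S,
   so the first set difference below is the set of its non-isolated points. *)
Definition nontrivial_cvg_sequence (X : topologicalType) (S : set X) : Prop :=
  S #= [set: nat] /\
  exists2 x : X, S `\` isolated S = [set x] &
    forall U, nbhs x U -> finite_set (S `\` U).

Definition Sc (X : topologicalType) : set (hyperspace X) :=
  [set F | nontrivial_cvg_sequence (\val F)].

(* Only the values of f on [0, 1] matter, and [{within ...}] is continuity for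
   the subspace topology of [0, 1]. *)
Definition path_component (R : realType) (T : topologicalType) (x : T) :
    set T :=
  [set y | exists f : R -> T,
    [/\ {within `[0, 1], continuous f}, f 0 = x & f 1 = y]].

Definition path_components (R : realType) (T : topologicalType) :
    set (set T) :=
  range (@path_component R T).

Definition warsaw1 (R : realType) : set (R * R) :=
  [set (a, `|sin (pi / a)|) | a in `]0, 1] ].

Definition warsaw2 (R : realType) : set (R * R) :=
  [set p | (p.1 - 1 / 2) ^+ 2 + p.2 ^+ 2 = 1 / 4 /\ p.2 < 0].

Definition warsaw3 (R : realType) : set (R * R) :=
  [set (0, b) | b in `[0, 1] ].

Definition warsaw_circle (R : realType) : set (R * R) :=
  @warsaw1 R `|` @warsaw2 R `|` @warsaw3 R.

Arguments path_components : clear implicits.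
Arguments warsaw_circle : clear implicits.

(* Main.v *)
Require Import Defs.
From mathcomp Require Import all_boot all_order all_algebra.
From mathcomp Require Import all_classical all_reals all_analysis.
From mathcomp Require Import ring lra.
Import Order.TTheory GRing.Theory Num.Theory.
Import numFieldNormedType.Exports.

Set Implicit Arguments.
Unset Strict Implicit.
Unset Printing Implicit Defensive.

Local Open Scope classical_set_scope.
Local Open Scope ring_scope.
Local Open Scope card_scope.

(** The Warsaw circle contains the arc of points (1/s, |sin (pi s)|), s >= 1,
    whose arches accumulate on the segment {0} x [0, 1].  A closed set S is read
    along this arc through its set A(S) of parameters s ([arc_parameters]).

    Far along the arc, a path of convergent sequences can move A(S) only a
    bounded distance.  Indeed S is countable, so it misses some point (0, c)
    with c in [0, 1].  Since S is closed, the sequences T close to S avoid a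
    neighbourhood of that point, hence all the points of the arc at height c
    with parameters n + a, where |sin (pi a)| = c and n is large
    ([arc_parameters_gap]).  These points cut the end of the arc into slots
    ]n + a, n + 1 + a[ that no parameter can leave: whether A(T) meets a given
    slot is locally constant along the path, being open on the open slot
    ([arc_parameters_meet_open]) and closed on the closed one
    ([arc_parameters_miss_open]).  So along a short piece of path the ends of
    the sets A(T) stay at Hausdorff distance at most 1
    ([path_locally_coarse]).  The limit of T may jump and c depends on S, but
    only finitely many short pieces are needed: as being at bounded distance
    near infinity is transitive, connectedness of [0, 1] extends it to the two
    ends of the path ([path_coarse]).

    It remains to find continuum many sequences at pairwise infinite distance.
    For r in [0, 1], take the points (1/k, 0) with k = 4^n + floor (2^n r), which
    converge to the origin.  Two such sets of parameters drift apart: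
    distinct blocks n are exponentially far, and within the block n the
    parameters for r and r' differ by about 2^n |r - r'| ([foot_index_apart]).

    There are no more than continuum many closed sets, because a closed subset
    of a second countable space is determined by the basic open sets that it
    meets ([card_hyperspace_le]), and sets of natural numbers embed in the line
    by ternary expansions ([card_set_nat_le]). *)

(** * Counting closed sets *)

(** The ternary expansions with digits 0 and 1 are unique: at the first digit
    where two of them differ, the gap exceeds all that the later digits can
    contribute. *)
Lemma card_set_nat_le (R : realType) : [set: set nat] #<= [set: R].
Proof.
pose w n : R := 3^-1 ^+ n.
have wS n : w n = 3 * w n.+1 by rewrite /w exprS; lra.
have w0 n : 0 < w n by rewrite exprn_gt0.
pose p (B : set nat) n := \sum_(0 <= k < n) (k \in B)%:R * w k.
have pS B n : p B n.+1 = p B n + (n \in B)%:R * w n by rewrite /p big_nat_recr.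
have b01 (b : bool) : 0 <= (b%:R : R) <= 1 by case: b; rewrite /= lexx ler01.
have pincr B n m : (n <= m)%N -> p B n <= p B m.
  elim: m => [|m IH]; first by rewrite leqn0 => /eqP ->.
  rewrite leq_eqVlt => /orP[/eqP -> //|/IH pnm]; rewrite pS.
  by have := b01 (m \in B); have := w0 m; nra.
(* the part of the expansion beyond the digit n weighs at most half of w n *)
have ptail B n m : p B m <= p B n.+1 + w n / 2.
  have tail k : p B (n.+1 + k)%N + w (n.+1 + k)%N * 3 / 2 <= p B n.+1 + w n / 2.
    elim: k => [|k IH]; first by rewrite addn0 (wS n); lra.
    rewrite addnS pS; apply: le_trans IH.
    by rewrite (wS (n.+1 + k)%N); have := b01 ((n.+1 + k)%N \in B);
      have := w0 (n.+1 + k).+1; nra.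
  case: (leqP m n.+1) => [/(pincr B)|/ltnW/subnKC <-].
    by have := w0 n; lra.
  by have := tail (m - n.+1)%N; have := w0 (n.+1 + (m - n.+1))%N; lra.
pose c B := sup (range (p B)).
have c_ub B n : p B n <= c B.
  apply: ub_le_sup; last by exists n.
  by exists (p B 1%N + w 0%N / 2) => _ [m _ <-]; exact: ptail.
have c_lt B B' n : p B n = p B' n -> n \in B -> n \notin B' -> c B' < c B.
  move=> e nB nB'; have pB' : p B' n.+1 = p B' n.
    by rewrite pS (negbTE nB') mul0r addr0.
  have pB : p B n.+1 = p B' n + w n by rewrite pS nB mul1r e.
  have cB' : c B' <= p B' n + w n / 2.
    apply: ge_sup => [|_ [m _ <-]]; first by exists (p B' 0%N), 0%N.
    by rewrite -pB'; exact: ptail.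
  by have := c_ub B n.+1; rewrite pB; have := w0 n; lra.
apply/pcard_injP; exists c => B B' _ _ cBB'; apply: contrapT => BB'.
have /ex_minnP[n nBB' nmin] : exists n, (n \in B) != (n \in B').
  apply: contrapT => h; apply: BB'; apply/seteqP; split=> n nB;
    move/forallNP/(_ n)/negP: h; rewrite negbK (mem_set nB) ?[true == _]eq_sym;
    by move=> /eqP/set_mem.
have e : p B n = p B' n.
  apply: eq_big_nat => k /andP[_ kn]; congr ((nat_of_bool _)%:R * _); apply/eqP.
  by apply: contraTT kn => kBB'; rewrite -leqNgt; exact: nmin.
case: (boolP (n \in B)) nBB' => nB; case: (boolP (n \in B')) => nB' // _.
  by have := c_lt _ _ _ e nB nB'; rewrite cBB' ltxx.
by have := c_lt _ _ _ (esym e) nB' nB; rewrite cBB' ltxx.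
Qed.

(** Distinct closed sets are separated by a point of one with a basic
    neighbourhood missing the other. *)
Lemma card_hyperspace_le (X : topologicalType) :
  @second_countable X -> [set: hyperspace X] #<= [set: set nat].
Proof.
move=> [B /countable_injP[g ginj] [Bopen Bnbhs]].
pose code (F : hyperspace X) :=
  [set n | exists U, [/\ B U, g U = n & \val F `&` U !=set0]].
have sub F G : code F = code G -> \val F `<=` \val G.
  move=> FG x Fx; apply: contrapT => Gx.
  have [clG _] : closed_nonempty (\val G) := set_valP G.
  have [|U [BU Ux] UG] := Bnbhs x (~` \val G).
    by apply: open_nbhs_nbhs; split=> //; exact: closed_openC.
  have : code F (g U) by exists U; split=> //; exists x.
  rewrite FG => -[V [BV /ginj VU [y [Gy Vy]]]].
  by apply: (UG y) => //; rewrite -VU ?inE.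
apply/pcard_injP; exists code => F G _ _ FG; apply: val_inj.
by apply/seteqP; split; apply: sub.
Qed.


Lemma second_countable_subplane (R : realType) (A : set (R * R)) :
  @second_countable (set_type A).
Proof.
pose box (q : rat * rat * rat * rat) := [set x : R * R |
  (ratr q.1.1.1 < x.1 < ratr q.1.1.2) && (ratr q.1.2 < x.2 < ratr q.2)].
have box_open q : open (box q).
  rewrite openE => x /andP[/andP[x1 x2] /andP[x3 x4]].
  pose e := Num.min (Num.min (x.1 - ratr q.1.1.1) (ratr q.1.1.2 - x.1))
    (Num.min (x.2 - ratr q.1.2) (ratr q.2 - x.2)).
  apply/nbhs_ballP; exists e; first by rewrite /= !lt_min !subr_gt0 x1 x2 x3.
  move=> y [] /=; rewrite /ball /= !lt_min.
  move=> /andP[/andP[a b] _] /andP[_ /andP[c d]].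
  rewrite /box /=.
  by move: a b c d; rewrite !ltr_norml; lra.
exists (range (fun q => (\val : set_type A -> _) @^-1` box q)).
  apply: card_le_trans (card_image_le _ _) _; exact: countableP.
split=> [_ [q _ <-]|x U]; first by exists (box q).
rewrite nbhsE => -[_ [[V oV <-] Vx] VU].
have /nbhs_ballP[e /= e0 eV] : nbhs (\val x) V by apply: open_nbhs_nbhs.
have rat_lt (a b : R) : a < b -> exists q, a < ratr q < b.
  by move=> /rat_in_itvoo[q]; rewrite in_itv; exists q.
have [|q1 qP1] := rat_lt ((\val x).1 - e) (\val x).1; first by lra.
have [|q2 qP2] := rat_lt (\val x).1 ((\val x).1 + e); first by lra.
have [|q3 qP3] := rat_lt ((\val x).2 - e) (\val x).2; first by lra.
have [|q4 qP4] := rat_lt (\val x).2 ((\val x).2 + e); first by lra.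
exists (\val @^-1` box (q1, q2, q3, q4)).
  split; first by exists (q1, q2, q3, q4).
  by rewrite /box /=; lra.
move=> y; rewrite /box /= => yb; apply: VU; apply: eV.
by split; rewrite /ball /= ltr_norml; lra.
Qed.

(** * Continuity for the Vietoris topology *)

Lemma vietoris_open_sub (X : topologicalType) (U : set X) :
  open U -> open [set F : hyperspace X | \val F `<=` U].
Proof.
move=> oU; rewrite vietoris_openE.
have [U0|/set0P/negP/negPn/eqP U0] := pselect (U !=set0).
  exists [set [set U]] => [_ -> |].
    split; [exact: finite_set1|by exists U|by move=> _ ->].
  rewrite bigcup_set1; apply/seteqP; split=> F /=.
    by case=> FU _ x /FU[_ ->].
  move=> FU; split=> [x /FU Ux|_ ->]; first by exists U.
  have [_ [x Fx]] : closed_nonempty (\val F) := set_valP F.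
  by exists x; split=> //; exact: FU.
exists set0 => //; rewrite bigcup_set0; apply/esym/seteqP; split=> // F /=.
have [_ [x Fx]] : closed_nonempty (\val F) := set_valP F.
by move=> /(_ x Fx); rewrite U0.
Qed.

Lemma vietoris_open_meet (X : topologicalType) (U : set X) :
  open U -> open [set F : hyperspace X | \val F `&` U !=set0].
Proof.
move=> oU; rewrite vietoris_openE.
have [U0|/set0P/negP/negPn/eqP U0] := pselect (U !=set0).
  (* adding the whole space frees the family from the covering condition *)
  exists [set [set U; setT]] => [_ -> |].
    split; [exact: finite_set2|by exists U; left|].
    move=> _ [->|->] //; split; first exact: openT.
    by case: U0 => x _; exists x.
  rewrite bigcup_set1; apply/seteqP; split=> F /=.
    by case=> _; apply; left.
  move=> FU; split=> [x _|_ [->|->] //]; first by exists setT => //; right.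
  by case: FU => x [Fx _]; exists x.
exists set0 => //; rewrite bigcup_set0; apply/esym/seteqP; split=> // F /=.
by rewrite U0 setI0 => -[].
Qed.

(** A relation that is a partial equivalence and holds between nearby points has
    open classes, so a connected set lies in a single class. *)
Lemma connected_locally_related (T : topologicalType) (A : set T)
    (E : T -> T -> Prop) :
  (forall s t, E s t -> E t s) -> (forall s t u, E s t -> E t u -> E s u) ->
  (forall t, A t -> \forall u \near t, A u -> E t u) ->
  connected A -> forall s t, A s -> A t -> E s t.
Proof.
move=> symE trE locE cA s t As At.
have Ess : E s s by exact: nbhs_singleton (locE s As) As.
suff BA : A `&` [set u | E s u] = A by move: At; rewrite -BA => -[].
apply: cA; first by exists s.
- exists [set u | A u -> E s u]°; first exact: open_interior.
  apply/seteqP; split=> u [Au]; last first.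
    by move=> /interior_subset /(_ Au).
  move=> Esu; split=> //; apply: filterS (locE u Au) => v /[apply].
  exact: trE.
- exists (~` [set u | A u -> ~ E s u]°).
    exact/open_closedC/open_interior.
  apply/seteqP; split=> u [Au] Esu; split=> //.
    by move=> /interior_subset /(_ Au).
  apply: contrapT => nEsu; apply: Esu.
  apply: filterS (locE u Au) => v /[apply] Euv Esv; apply: nEsu.
  exact: trE Esv (symE _ _ Euv).
Qed.

(** * Convergent sequences as sets *)

Lemma subspace_hausdorff (X : topologicalType) (A : set X) :
  hausdorff_space X -> hausdorff_space (set_type A).
Proof.
rewrite !open_hausdorff => hX x y xy.
have [|[U V] /= [Ux Vy] [oU oV /eqP UV0]] := hX (\val x) (\val y).
  by apply: contra xy => /eqP /val_inj ->.
exists (\val @^-1` U, \val @^-1` V) => /=.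
  by split; apply: mem_set; [move: Ux|move: Vy]; rewrite inE.
split; [by exists U|by exists V|].
by rewrite -preimage_setI UV0 preimage_set0.
Qed.

Section cvg_sequence.
Context (X : topologicalType) (p : X) (u : nat -> X).
Hypotheses (hX : hausdorff_space X) (uinj : injective u).
Hypotheses (up : forall n, u n <> p) (ucvg : u @ \oo --> p).

Let S := p |` range u.

Lemma cvg_sequence_cofinite U :
  nbhs p U -> exists N, forall n, (N <= n)%N -> U (u n).
Proof. by move=> /ucvg[N _ NU]; exists N => n; exact: NU. Qed.

(** This gives both that the points of the sequence are isolated and that no
    point outside the set is adherent to it: away from the limit, only finitely
    many terms matter, and finite sets are closed. *)
Lemma cvg_sequence_separated q :
  q <> p -> exists2 V, nbhs q V & V `&` S `<=` [set q].
Proof.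
move=> /eqP qp; have := hX; rewrite open_hausdorff => /(_ q p qp).
move=> [[A B] /=]; rewrite !inE => -[Aq Bp] [oA oB AB0].
have [N NB] := cvg_sequence_cofinite (open_nbhs_nbhs (conj oB Bp)).
pose Z := (u @` `I_N) `\` [set q].
have cZ : closed Z.
  move/hausdorff_accessible/accessible_finite_set_closed: hX; apply.
  exact/finite_setD/finite_image/finite_II.
exists (A `&` ~` Z).
  apply: open_nbhs_nbhs; split; first by apply: openI => //; exact: closed_openC.
  by split=> // -[_]; apply.
move=> x [[Ax Zx]] [xp|[n _ unx]]; apply: contrapT => xq.
  by have : (A `&` B) x by [rewrite xp in Ax *]; rewrite AB0.
apply: Zx; split=> //; exists n => //=; rewrite ltnNge; apply/negP => /NB.
by rewrite unx => Bx; have : (A `&` B) x by []; rewrite AB0.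
Qed.

Lemma cvg_sequence_closed : closed S.
Proof.
move=> q clSq; have [->|/cvg_sequence_separated[V qV VS]] := pselect (q = p).
  by left.
have [x [Sx Vx]] := clSq V qV.
by have <- : x = q by exact: VS.
Qed.

Lemma cvg_sequence_nontrivial : nontrivial_cvg_sequence S.
Proof.
split.
  pose v n := if n is m.+1 then u m else p.
  have -> : S = range v.
    apply/seteqP; split=> [x [->|[n _ <-]]|_ [[|n] _ <-]].
    - by exists 0%N.
    - by exists n.+1.
    - by left.
    - by right; exists n.
  apply: inj_card_eq => -[|m] [|n] _ _ //= e.
  - by case: (up (esym e)).
  - by case: (up e).
  - by rewrite (uinj e).
exists p => [|U pU].
  apply/seteqP; split=> [x [Sx nx]|_ ->].
    apply: contrapT => xp; have [V xV VS] := cvg_sequence_separated xp.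
    apply: nx; split; first exact: mem_set.
    exists V => //; apply/seteqP; split=> // _ ->; split=> //.
    exact: nbhs_singleton.
  split; first by left.
  move=> [_ [V /cvg_sequence_cofinite[N NV] VS]].
  apply: (up (n := N)); rewrite -[_ = p]/([set p] _) -VS.
  by split; [exact: NV|right; exists N].
have [N NU] := cvg_sequence_cofinite pU.
apply: sub_finite_set (finite_image u (finite_II N)) => x [[->|[n _ <-]] Ux].
  by case: Ux; exact: nbhs_singleton.
exists n => //=; rewrite ltnNge; apply/negP => /NU; exact: Ux.
Qed.

End cvg_sequence.

(** * Parameters along the oscillating arc *)

Section warsaw.
Variable R : realType.

Notation X := (set_type (warsaw_circle R)).

(** The point of the arc at abscissa a is indexed by s = 1 / a, so that the
    arches have parameter length 1 and recede to infinity. *)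
Definition arc_parameters (S : set X) : set R :=
  [set s | 1 <= s /\ exists2 x, S x & \val x = (s^-1, `|sin (pi * s)|)].

Lemma abs_sin_shift n (a : R) : `|sin (pi * (n%:R + a))| = `|sin (pi * a)|.
Proof.
elim: n => [|n IH]; first by rewrite add0r.
rewrite -[RHS]IH; have -> : pi * (n.+1%:R + a) = pi * (n%:R + a) + pi.
  by rewrite -(natr1 n); ring.
by rewrite sinDpi normrN.
Qed.

Lemma warsaw_arcP (s : R) : 1 <= s -> warsaw_circle R (s^-1, `|sin (pi * s)|).
Proof.
move=> s1; left; left; exists s^-1; last by rewrite invrK.
by rewrite /= in_itv /= invr_gt0 invf_le1 ?s1 ?andbT; lra.
Qed.

(** The inequality excludes the lower half circle, where -1 < b < 0 makes
    a - a^2 = b^2 smaller than -b; it leaves room below the arc, so that its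
    strict form defines an open set. *)
Lemma warsaw_arc_region (x : X) :
  0 < (\val x).1 -> (\val x).1 ^+ 2 - (\val x).1 <= (\val x).2 ->
  exists2 s, 1 <= s & \val x = (s^-1, `|sin (pi * s)|).
Proof.
have := set_valP x; case: (\val x) => a b /= [[[a' /=]|]|[b' _ [<- _]]];
  last by rewrite ltxx.
  rewrite in_itv /= => /andP[a0 a1] [<- <-] _ _; exists a'^-1.
    by rewrite invf_ge1.
  by rewrite invrK.
rewrite /warsaw2 /= => -[ab b0] a0 ab'.
have e : b ^+ 2 = a - a ^+ 2 by move: ab; lra.
have : -1 < b by nra.
by nra.
Qed.

Lemma open_positive_preimage (g : R * R -> R) :
  continuous g -> open [set x : X | 0 < g (\val x)].
Proof.
move=> cg; exists (g @^-1` [set y | 0 < y]) => //.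
by apply: open_comp => [q _|]; [exact: cg|exact: open_gt].
Qed.

(** Over an open interval of abscissas in ]0, 1[ the arc is open in the Warsaw
    circle. *)
Lemma arc_parameters_meet_open (a b : R) : 1 <= a -> open
  [set F : hyperspace X | arc_parameters (\val F) `&` `]a, b[ !=set0].
Proof.
move=> a1; pose V := [set x : X | 0 < a^-1 - (\val x).1] `&`
  [set x : X | 0 < (\val x).1 - b^-1] `&`
  [set x : X | 0 < (\val x).1] `&`
  [set x : X | 0 < (\val x).2 - ((\val x).1 ^+ 2 - (\val x).1)].
have oV : open V.
  repeat apply: openI.
  - apply: (open_positive_preimage (g := fun q => a^-1 - q.1)) => q.
    by apply: cvgB; [exact: cvg_cst|exact: cvg_fst].
  - apply: (open_positive_preimage (g := fun q => q.1 - b^-1)) => q.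
    by apply: cvgB; [exact: cvg_fst|exact: cvg_cst].
  - by apply: (open_positive_preimage (g := fst)) => q; exact: cvg_fst.
  - apply: (open_positive_preimage (g := fun q => q.2 - (q.1 ^+ 2 - q.1))) => q.
    apply: cvgB; first exact: cvg_snd.
    by apply: cvgB; [apply: cvgM; exact: cvg_fst|exact: cvg_fst].
have [ab|ba] := ltP a b; last first.
  rewrite (_ : [set _ | _] = set0); first exact: open0.
  apply/seteqP; split=> // F [s [_]]; rewrite /= in_itv /=; lra.
rewrite (_ : [set _ | _] = [set F | \val F `&` V !=set0]).
  exact: vietoris_open_meet.
apply/seteqP; split=> F.
  move=> [s [[s1 [x Fx xs]]]]; rewrite /= in_itv /= => /andP[sa sb].
  exists x; split=> //; rewrite /V /= xs /=.
  have sp : 0 < s^-1 by rewrite invr_gt0; lra.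
  have s1' : s^-1 < 1 by rewrite invf_lt1; lra.
  have := normr_ge0 (sin (pi * s)).
  rewrite !subr_gt0 !ltf_pV2 ?posrE; try lra.
  by move=> ?; do !split => //; nra.
move=> [x [Fx]]; rewrite /V /= => -[[[xa xb] x0] x2].
have [||s s1 xs] := @warsaw_arc_region x; [by []|lra|].
exists s; split; first by split=> //; exists x.
rewrite /= in_itv /=; move: xa xb; rewrite xs /= !subr_gt0 !ltf_pV2 ?posrE; lra.
Qed.

(** Over a compact range of positive abscissas the arc is closed in the Warsaw
    circle. *)
Lemma arc_parameters_miss_open (a b : R) : 1 <= a -> open
  [set F : hyperspace X | arc_parameters (\val F) `&` `[a, b] = set0].
Proof.
move=> a1; pose V := [set x : X | 0 < (\val x).1 - a^-1] `|`
  [set x : X | 0 < b^-1 - (\val x).1] `|`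
  [set x : X | 0 < - (\val x).2].
have oV : open V.
  repeat apply: openU.
  - apply: (open_positive_preimage (g := fun q => q.1 - a^-1)) => q.
    by apply: cvgB; [exact: cvg_fst|exact: cvg_cst].
  - apply: (open_positive_preimage (g := fun q => b^-1 - q.1)) => q.
    by apply: cvgB; [exact: cvg_cst|exact: cvg_fst].
  - apply: (open_positive_preimage (g := fun q => - q.2)) => q.
    by apply: cvgN; exact: cvg_snd.
have [ab|ba] := leP a b; last first.
  rewrite (_ : [set _ | _] = setT); first exact: openT.
  apply/seteqP; split=> // F _; apply/seteqP; split=> // s [_].
  by rewrite /= in_itv /=; lra.
have b0 : 0 < b^-1 by rewrite invr_gt0; lra.
rewrite (_ : [set _ | _] = [set F | \val F `<=` V]).
  exact: vietoris_open_sub.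
apply/seteqP; split=> F.
  move=> Fab x Fx; apply: contrapT => /not_orP[/not_orP[/= xa xb] x2].
  have a1' : a^-1 <= 1 by rewrite invf_le1; lra.
  have [||s s1 xs] := @warsaw_arc_region x; [lra|nra|].
  have : (arc_parameters (\val F) `&` `[a, b]) s; last by rewrite Fab.
  split; first by split=> //; exists x.
  move: xa xb; rewrite xs /= !subr_gt0 in_itv /= !ltf_pV2 ?posrE; lra.
move=> FV; apply/seteqP; split=> // s [[s1 [x Fx xs]]].
rewrite /= in_itv /= => /andP[sa sb]; have := FV x Fx.
have := normr_ge0 (sin (pi * s)).
rewrite /V /= xs /= !subr_gt0 !ltf_pV2 ?posrE; lra.
Qed.

(** A countable set has measure zero, the segment has measure one. *)
Lemma exists_missed_height (S : set X) :
  countable S -> exists2 c : R, 0 <= c <= 1 & forall x, S x -> \val x <> (0, c).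
Proof.
move=> cS; apply: contrapT => nc.
have : countable `[(0 : R), 1].
  apply: sub_countable cS.
  apply: card_le_trans (card_image_le (fun x : X => (\val x).2) S).
  apply: subset_card_le => c; rewrite /= in_itv /= => c01; apply: contrapT => Sc.
  apply: nc; exists c => // x Sx xc; apply: Sc; exists x => //; by rewrite xc.
move=> /countable_lebesgue_measure0; rewrite lebesgue_measure_itv /= lte_fin ltr01.
by rewrite oppr0 adde0 => /eqP; rewrite eqe oner_eq0.
Qed.

(** The set U removes a closed square around a point (0, c) that S misses; the
    points of the arc at height c eventually enter this square. *)
Lemma arc_parameters_gap (S : hyperspace X) : Sc S ->
  exists (U : set X) (a N : R), [/\ open U, \val S `<=` U, 0 <= a &
    forall (T : set X) (n : nat), T `<=` U -> N <= n%:R ->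
      ~ arc_parameters T (n%:R + a)].
Proof.
move=> [cS _].
have [|c c01 Sc] := @exists_missed_height (\val S).
  by move: cS; rewrite card_eq_le => /andP[].
have pi0 : 0 < pi :> R := pi_gt0 R.
(* the summand 1, invisible to the height, makes a nonnegative *)
pose a := 1%:R + asin c / pi.
have sina : `|sin (pi * a)| = c.
  rewrite abs_sin_shift mulrC divfK ?gt_eqF// asinK ?in_itv /=; last lra.
  by rewrite ger0_norm; lra.
have a0 : 0 <= a.
  have : - 2^-1 <= asin c / pi.
    by rewrite ler_pdivlMr // mulNr mulrC; apply: asin_geNpi2; lra.
  by rewrite /a; lra.
have Wc : warsaw_circle R (0, c) by right; exists c.
pose x0 : X := exist _ (0, c) (mem_set Wc).
have [clS _] : closed_nonempty (\val S) := set_valP S.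
have /closed_openC[V oV VS] := clS.
have /nbhs_ballP[e /= e0 eV] : nbhs (0, c) V.
  apply: open_nbhs_nbhs; split=> //.
  have : (~` \val S) x0 by move=> /Sc.
  by rewrite -VS.
pose U := [set x : X | 0 < (\val x).1 - e / 2] `|`
  [set x : X | 0 < - (e / 2) - (\val x).1] `|`
  [set x : X | 0 < (\val x).2 - (c + e / 2)] `|`
  [set x : X | 0 < (c - e / 2) - (\val x).2].
exists U, a, (2 / e + 1); split=> //.
- repeat apply: openU.
  + apply: (open_positive_preimage (g := fun q => q.1 - e / 2)) => q.
    by apply: cvgB; [exact: cvg_fst|exact: cvg_cst].
  + apply: (open_positive_preimage (g := fun q => - (e / 2) - q.1)) => q.
    by apply: cvgB; [exact: cvg_cst|exact: cvg_fst].
  + apply: (open_positive_preimage (g := fun q => q.2 - (c + e / 2))) => q.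
    by apply: cvgB; [exact: cvg_snd|exact: cvg_cst].
  + apply: (open_positive_preimage (g := fun q => (c - e / 2) - q.2)) => q.
    by apply: cvgB; [exact: cvg_cst|exact: cvg_snd].
- move=> x Sx; apply: contrapT => /not_orP[/not_orP[/not_orP[/= x1 x1'] x2] x3].
  have : (~` \val S) x.
    by rewrite -VS; apply: eV; split; rewrite /ball /= ltr_norml; lra.
  by apply.
- move=> T n TU Nn [s1 [x Tx xs]]; have := TU x Tx.
  rewrite /U /= xs abs_sin_shift sina /=.
  have e2 : (n%:R + a)^-1 <= e / 2.
    rewrite -[e / 2]invrK lef_pV2 ?posrE ?invr_gt0; [|lra|lra].
    by rewrite invf_div; lra.
  have : 0 < (n%:R + a)^-1 by rewrite invr_gt0; lra.
  by lra.
Qed.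

(** * Paths move the parameters a bounded distance *)

(** Near plus infinity, A lies in a bounded neighbourhood of B. *)
Definition coarsely_inside (A B : set R) := exists M N : R,
  forall s, A s -> N <= s -> exists2 t, B t & `|s - t| <= M.

Lemma coarsely_inside_trans (A B C : set R) :
  coarsely_inside A B -> coarsely_inside B C -> coarsely_inside A C.
Proof.
move=> [M [N AB]] [M' [N' BC]].
exists (M + M'), (Num.max N (N' + M)) => s As.
rewrite ge_max => /andP[Ns N's]; have [t Bt st] := AB s As Ns.
have [|u Cu tu] := BC t Bt; first by move: st; rewrite ler_norml; lra.
exists u => //; rewrite (_ : s - u = (s - t) + (t - u)); last lra.
by apply: le_trans (ler_normD _ _) _; exact: lerD.
Qed.

Section path.
Variables (f : R -> hyperspace X) (A : set R).
Hypotheses (iA : is_interval A) (cf : {within A, continuous f}).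

Lemma path_near (t : R) (W : set (hyperspace X)) :
  A t -> open W -> W (f t) -> \forall u \near t, A u -> W (f u).
Proof.
move=> At oW Wt; change (within A (nbhs t) (f @^-1` W)).
rewrite (nbhs_subspace_in At).
exact: (@cf t _ (open_nbhs_nbhs (conj oW Wt))).
Qed.

(** The set of slots met by the arc parameters is constant near t, up to
    finitely many slots, and a slot has length 1. *)
Lemma path_locally_coarse (t : R) : A t -> Sc (f t) ->
  \forall u \near t, A u ->
    coarsely_inside (arc_parameters (\val (f t))) (arc_parameters (\val (f u))) /\
    coarsely_inside (arc_parameters (\val (f u))) (arc_parameters (\val (f t))).
Proof.
move=> At /arc_parameters_gap[U [a [N [oU tU a0 Ugap]]]].
have := path_near At (vietoris_open_sub oU) tU.
move=> /nbhs_ballP[d /= d0 dU].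
pose J := A `&` ball t d.
have cJ : connected J.
  apply/connected_intervalP => x y [Ax tx] [Ay ty] z xzy; split.
    exact: iA Ax Ay z xzy.
  by move: tx ty; rewrite /ball /= !ltr_norml; lra.
have JU u : J u -> \val (f u) `<=` U by move=> [Au /dU]; apply.
pose slot n u := arc_parameters (\val (f u)) `&` `]n%:R + a, n.+1%:R + a[ !=set0.
have slot_same n u v : Num.max N 1 <= n%:R -> J u -> J v -> slot n u -> slot n v.
  rewrite ge_max => /andP[Nn n1] Ju Jv; suff : slot n u <-> slot n v by case.
  have na1 : 1 <= n%:R + a by lra.
  move: u v Ju Jv; apply: connected_locally_related cJ; [tauto|tauto|].
  move=> u Ju; have [Au _] := Ju; have [nu|nu] := pselect (slot n u).
    apply: filterS (path_near Au (arc_parameters_meet_open _ na1) nu) => v nv [Av _].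
    by split=> // _; exact: nv.
  (* the ends of the slot are never reached, so missing the open slot is
     missing the closed one, which persists nearby *)
  have uC : arc_parameters (\val (f u)) `&` `[n%:R + a, n.+1%:R + a] = set0.
    apply/seteqP; split=> // s [us]; rewrite /= in_itv /= => /andP[s1 s2].
    apply: nu; exists s; split=> //; rewrite /= in_itv /= !lt_neqAle s1 s2 !andbT.
    apply/andP; split; apply/eqP => e.
      by apply: (Ugap _ n (JU u Ju)) => //; rewrite e.
    by apply: (Ugap _ n.+1 (JU u Ju)); [rewrite -natr1; lra|rewrite -e].
  apply: filterS (path_near Au (arc_parameters_miss_open _ na1) uC) => v vC [Av _].
  split=> // -[s [vs sn]]; have : set0 s; last by [].
  rewrite -(vC Av); split=> //; move: sn; rewrite /= !in_itv /=; lra.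
have inside u v : J u -> J v ->
    coarsely_inside (arc_parameters (\val (f u))) (arc_parameters (\val (f v))).
  move=> Ju Jv; exists 1, (Num.max N 1 + 1 + a) => s us Ns.
  have N1 : 1 <= Num.max N 1 by rewrite le_max lexx orbT.
  have /truncn_itv : 0 <= s - a by lra.
  set n := Num.truncn _ => /andP[ns sn].
  have Nn : Num.max N 1 <= n%:R by move: sn; rewrite -natr1; lra.
  have [|r [vr]] := slot_same n u v Nn Ju Jv.
    exists s; split=> //; rewrite /= in_itv /= !lt_neqAle -andbA; apply/and4P; split.
    - apply/eqP => e; apply: (Ugap _ n (JU u Ju)); last by rewrite e.
      by move: Nn; rewrite ge_max => /andP[].
    - by lra.
    - by lra.
    - by lra.
  rewrite /= in_itv /= => /andP[nr rn]; exists r => //.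
  by rewrite ler_norml; move: sn rn; rewrite -!natr1; lra.
have Jt : J t by split=> //; exact: ballxx.
apply/nbhs_ballP; exists d => //= u tu Au.
by split; apply: inside.
Qed.

End path.

(** The bounds and thresholds of the successive pieces of path add up; the
    statement is about some bound, so transitivity absorbs them. *)
Lemma path_coarse (f : R -> hyperspace X) :
  {within `[0, 1], continuous f} -> (forall t, Sc (f t)) ->
  coarsely_inside (arc_parameters (\val (f 0))) (arc_parameters (\val (f 1))).
Proof.
move=> cf Sf.
pose E t u :=
  coarsely_inside (arc_parameters (\val (f t))) (arc_parameters (\val (f u))) /\
  coarsely_inside (arc_parameters (\val (f u))) (arc_parameters (\val (f t))).
suff [] : E 0 1 by [].
apply: (@connected_locally_related R `[0, 1] E).
- by move=> s t [].
- move=> s t u [st ts] [tu ut]; split.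
    exact: coarsely_inside_trans st tu.
  exact: coarsely_inside_trans ut ts.
- by move=> t t01; apply: path_locally_coarse => //; exact: interval_is_interval.
- exact: segment_connected.
- by rewrite /= in_itv /= lexx ler01.
- by rewrite /= in_itv /= lexx ler01.
Qed.

End warsaw.

(** * Continuum many sequences at infinite distance *)

Section witnesses.
Variable R : realType.

Notation X := (set_type (warsaw_circle R)).

(** The parameters k at which an arch of the arc touches the axis are the
    integers.  In the n-th block, starting at 4^n, the integer chosen encodes r
    to precision 2^-n. *)
Definition foot_index (r : R) (n : nat) : nat := 4 ^ n + Num.truncn (r * 2 ^+ n).

Lemma foot_index_bounds (r : R) n : 0 <= r <= 1 ->
  [/\ (2 ^+ n) ^+ 2 <= (foot_index r n)%:R :> R,
      (2 ^+ n) ^+ 2 + (r * 2 ^+ n - 1) < (foot_index r n)%:R :> R &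
      (foot_index r n)%:R <= (2 ^+ n) ^+ 2 + r * 2 ^+ n :> R].
Proof.
move=> /andP[r0 r1]; have /truncn_itv : 0 <= r * 2 ^+ n.
  by rewrite mulr_ge0 // exprn_ge0.
rewrite /foot_index natrD natrX; set k := Num.truncn _; rewrite -(natr1 k).
have -> : 4%:R ^+ n = (2 ^+ n) ^+ 2 :> R by rewrite exprAC; congr (_ ^+ _); ring.
by have := ler0n R k; split; lra.
Qed.

Lemma foot_index_gt (r : R) n : (n < foot_index r n)%N.
Proof. exact: leq_trans (ltn_expl n (isT : 1 < 4)%N) (leq_addr _ _). Qed.

(** With Q = 2^n large: the choices of the block n for r and r' are at distance
    at least |r - r'| Q - 1, and the other blocks are at distance at least of
    order Q. *)
Lemma foot_index_apart (r r' : R) (M N : R) :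
  0 <= r <= 1 -> 0 <= r' <= 1 -> r != r' ->
  exists2 n, N <= (foot_index r n)%:R &
    forall m, M < `|(foot_index r n)%:R - (foot_index r' m)%:R|.
Proof.
move=> r01 r'01 rr'; pose d := `|r - r'|.
have d0 : 0 < d by rewrite normr_gt0 subr_eq0.
have d1 : d <= 1 by rewrite ler_norml; lra.
pose B := Num.max N (Num.max ((M + 1) / d) 0).
pose n := Num.truncn B.
have Q1 k : 1 <= 2 ^+ k :> R by rewrite exprn_ege1 ?ler1n.
have nB : B <= 2 ^+ n.
  have B0 : 0 <= B by rewrite !le_max lexx !orbT.
  have /andP[_ /ltW] := truncn_itv B0; move/le_trans; apply.
  by rewrite -natrX ler_nat ltn_expl.
move: nB; rewrite !ge_max ler_pdivrMr // => /and3P[NQ MQ _].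
exists n => [|m].
  by have [] := foot_index_bounds n r01; have := Q1 n; nra.
have [b1 b2 b3] := foot_index_bounds n r01.
have [b1' b2' b3'] := foot_index_bounds m r'01.
have Qn := Q1 n; have Qm := Q1 m.
have MQn : M + 1 <= 2 ^+ n by nra.
have [mn|nm|mn] := ltngtP m n.
- have : 2 ^+ m * 2 <= 2 ^+ n :> R by rewrite -exprSr ler_eXn2l ?ltr1n.
  move: (2 ^+ m) (2 ^+ n) Qm Qn MQn b1 b3 b1' b3' {MQ NQ b2 b2'}.
  move=> q Q q1 Q1' MQ b1 b3 b1' b3' qQ.
  have h1 : r' * q <= q by nra.
  have h2 : q ^+ 2 * 4 <= Q ^+ 2 by nra.
  have h3 : Q * 2 <= Q ^+ 2 by nra.
  by rewrite ltr_normr; apply/orP; left; lra.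
- have : 2 ^+ n * 2 <= 2 ^+ m :> R by rewrite -exprSr ler_eXn2l ?ltr1n.
  move: (2 ^+ m) (2 ^+ n) Qm Qn MQn b1 b3 b1' b3' {MQ NQ b2 b2'}.
  move=> q Q q1 Q1' MQ b1 b3 b1' b3' qQ.
  have h1 : r * Q <= Q by nra.
  have h2 : Q ^+ 2 * 4 <= q ^+ 2 by nra.
  have h3 : Q <= Q ^+ 2 by nra.
  by rewrite ltr_normr; apply/orP; right; lra.
- rewrite mn in b2' b3' *; rewrite ltr_normr; move: MQ; rewrite /d.
  case: (ltP r r') => rr.
    by rewrite ltr0_norm => [MQ|]; [apply/orP; right; lra|lra].
  by rewrite ger0_norm => [MQ|]; [apply/orP; left; lra|lra].
Qed.

Lemma foot_warsaw (k : nat) : (0 < k)%N -> warsaw_circle R (k%:R^-1, 0).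
Proof.
move=> k0; have := @warsaw_arcP R k%:R; rewrite ler1n k0 => /(_ isT).
by have := @abs_sin_shift R k 0; rewrite addr0 => ->; rewrite mulr0 sin0 normr0.
Qed.

Lemma origin_warsaw : warsaw_circle R (0, 0).
Proof. by right; exists 0 => //; rewrite /= in_itv /= lexx ler01. Qed.

Definition origin : X := exist _ (0, 0) (mem_set origin_warsaw).

Definition foot (r : R) n : X :=
  exist _ ((foot_index r n)%:R^-1, 0)
    (mem_set (foot_warsaw (leq_ltn_trans (leq0n n) (foot_index_gt r n)))).

Lemma foot_index_inj (r : R) : 0 <= r <= 1 -> injective (foot_index r).
Proof.
move=> r01; suff lt m n : (m < n)%N -> (foot_index r m < foot_index r n)%N.
  by move=> m n e; have [/lt|/lt|//] := ltngtP m n; rewrite e ltnn.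
move=> mn; rewrite -(ltr_nat R).
have [_ _ bm] := foot_index_bounds m r01; have [bn _ _] := foot_index_bounds n r01.
have : 2 ^+ m * 2 <= 2 ^+ n :> R by rewrite -exprSr ler_eXn2l ?ltr1n.
have : 1 <= 2 ^+ m :> R by rewrite exprn_ege1 ?ler1n.
nra.
Qed.

Lemma foot_inj (r : R) : 0 <= r <= 1 -> injective (foot r).
Proof.
move=> r01 m n /(congr1 val) [] /invr_inj /eqP; rewrite eqr_nat => /eqP.
exact: foot_index_inj.
Qed.

Lemma foot_neq (r : R) n : foot r n <> origin.
Proof.
move=> /(congr1 val) [] /eqP; rewrite invr_eq0 pnatr_eq0 => /eqP e.
by have := foot_index_gt r n; rewrite e.
Qed.

Lemma foot_cvg (r : R) : foot r @ \oo --> origin.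
Proof.
move=> U; rewrite nbhsE => -[_ [[V oV <-] V0] VU].
have /nbhs_ballP[e /= e0 eV] : nbhs (0, 0) V by apply: open_nbhs_nbhs.
exists (Num.truncn e^-1) => // n /= en; apply: VU; apply: eV.
have /truncn_itv/andP[_ es] : 0 <= e^-1 by rewrite invr_ge0 ltW.
split; rewrite /ball /= ?subrr ?normr0 // sub0r normrN ger0_norm ?invr_ge0 //.
rewrite -[e]invrK ltf_pV2 ?posrE ?invr_gt0 // ?ltr0n.
  by apply: lt_le_trans es _; rewrite ler_nat (leq_ltn_trans en) ?foot_index_gt.
exact: leq_ltn_trans (foot_index_gt r n).
Qed.

Lemma warsaw_hausdorff : hausdorff_space X.
Proof. apply: subspace_hausdorff; exact: norm_hausdorff. Qed.

Definition feet (r : R) : set X := origin |` range (foot r).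

Lemma feet_closed (r : R) : closed_nonempty (feet r).
Proof.
split; last by exists origin; left.
apply: cvg_sequence_closed; [exact: warsaw_hausdorff|exact: foot_cvg].
Qed.

Definition feet_hyperpoint (r : R) : hyperspace X :=
  exist _ (feet r) (mem_set (feet_closed r)).

Lemma feet_Sc (r : R) : 0 <= r <= 1 -> Sc (feet_hyperpoint r).
Proof.
move=> r01; apply: cvg_sequence_nontrivial.
- exact: warsaw_hausdorff.
- exact: foot_inj.
- exact: foot_neq.
- exact: foot_cvg.
Qed.

Lemma arc_parameters_feet (r s : R) :
  arc_parameters (feet r) s <-> exists n, s = (foot_index r n)%:R.
Proof.
split=> [[s1 [x [->|[n _ <-]] []]]|[n ->]].
- by move=> /esym/eqP; rewrite invr_eq0 => /eqP s0; move: s1; rewrite s0 ler10.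
- by move=> /invr_inj <- _; exists n.
split; first by rewrite ler1n (leq_ltn_trans _ (foot_index_gt r n)).
exists (foot r n); first by right; exists n.
have := @abs_sin_shift R (foot_index r n) 0; rewrite addr0 => ->.
by rewrite mulr0 sin0 normr0.
Qed.

Lemma feet_not_coarse (r r' : R) : 0 <= r <= 1 -> 0 <= r' <= 1 -> r != r' ->
  ~ coarsely_inside (arc_parameters (feet r)) (arc_parameters (feet r')).
Proof.
move=> r01 r'01 rr' [M [N h]].
have [n Nn nM] := foot_index_apart M N r01 r'01 rr'.
have [|t /arc_parameters_feet[m ->]] := h (foot_index r n)%:R _ Nn.
  by apply/arc_parameters_feet; exists n.
by rewrite leNgt nM.
Qed.

End witnesses.

Lemma exists_injection_unit_interval (R : realType) :
  exists g : R -> R, injective g /\ forall x, 0 <= g x <= 1.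
Proof.
exists (fun x => (1 + expR x)^-1); split=> [x y /invr_inj /addrI /expR_inj //|x].
have := expR_gt0 x => e0.
by rewrite invr_ge0 invf_le1; lra.
Qed.

(* [warsaw_circle R] and [Sc _] are sets used as types, which carry the
   subspace topology; [set: R] has the cardinality of the continuum. *)
Theorem mainTheorem6 (R : realType) :
  path_components R (set_type (@Sc (set_type (warsaw_circle R)))) #= [set: R].
Proof.
rewrite card_eq_le; apply/andP; split.
  apply: card_le_trans (card_image_le _ _) _.
  apply: card_le_trans (card_set_nat_le R).
  apply: card_le_trans
    (card_hyperspace_le (@second_countable_subplane R (warsaw_circle R))).
  by rewrite (card_le_eql (card_setT _)) card_leT.
have [g [ginj g01]] := exists_injection_unit_interval R.
pose S x : set_type (@Sc (set_type (warsaw_circle R))) :=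
  exist _ (feet_hyperpoint (g x)) (mem_set (feet_Sc (g01 x))).
pose C x := path_component R (S x).
have Cinj : injective C.
  move=> x y Cxy; apply: ginj; apply/eqP/negPn/negP => gxy.
  have : C y (S y).
    exists (fun=> S y); split=> //; exact: cst_continuous.
  rewrite -Cxy => -[f [cf f0 f1]].
  apply: (feet_not_coarse (g01 x) (g01 y) gxy).
  have := @path_coarse R (fun t => \val (f t)).
  rewrite f0 f1; apply => [t|t]; last exact: set_valP.
  by apply: continuous_comp; [exact: cf|exact: initial_continuous].
have Csub : range C `<=`
    path_components R (set_type (@Sc (set_type (warsaw_circle R)))).
  by move=> _ [x _ <-]; exists (S x).
apply: card_le_trans (subset_card_le Csub).
have /card_eqPle[] // : range C #= [set: R].
by apply: inj_card_eq => ? ? _ _; exact: Cinj.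
Qed.
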